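(* Let $k\in\mathbb{N}$ and let $f:\mathbb{R}/\mathbb{Z}\to\mathbb{R}/\mathbb{Z}$ be an orientation-preserving piecewise contraction of the circle which has $k$ points of discontinuity on the circle $\mathbb{R}/\mathbb{Z}$ and which is right continuous at those points. Then $f$ has at most $k$ periodic orbits, and this upper bound is sharp (i.e. for every $k\in\mathbb{N}$ there is such a map with $k$ points of discontinuity having exactly $k$ periodic orbits).
   Context: $\mathbb{N}=\{1,2,\ldots\}$. A circle map $f$ with finitely many (at least one) discontinuity points is an orientation-preserving piecewise contraction if there exists $0<\lambda<1$ such that, for every connected component $D$ of the complement of the set of discontinuity points in $\mathbb{R}/\mathbb{Z}$, identifying the open arc $D$ with an open interval $(\alpha,\beta)\subset\mathbb{R}$, $\beta-\alpha\le 1$, via the projection $\mathbb{R}\to\mathbb{R}/\mathbb{Z}$, the restriction $f|_D$ has a continuous lift $(\alpha,\beta)\to\mathbb{R}$ that is strictly increasing and $\lambda$-Lipschitz. Right continuity is with respect to the positive orientation of the circle. A periodic orbit is the forward orbit of a periodic point. *)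

(* Defs.v *)
From HB Require Import structures.
From mathcomp Require Import all_boot all_order all_algebra generic_quotient.
From mathcomp Require Import all_classical all_reals all_analysis.

Set Implicit Arguments.
Unset Strict Implicit.
Unset Printing Implicit Defensive.

Import Order.TTheory GRing.Theory Num.Theory.
Import numFieldNormedType.Exports.

Local Open Scope classical_set_scope.
Local Open Scope ring_scope.
Local Open Scope quotient_scope.

Definition eqmodZ (R : realType) (x y : R) : bool := x - y \is a Num.int.

Lemma eqmodZ_refl (R : realType) : reflexive (@eqmodZ R).
Proof. by move=> x; rewrite /eqmodZ subrr rpred0. Qed.

Lemma eqmodZ_sym (R : realType) : symmetric (@eqmodZ R).
Proof. by move=> x y; rewrite /eqmodZ -opprB rpredN. Qed.

Lemma eqmodZ_trans (R : realType) : transitive (@eqmodZ R).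
Proof.
move=> y x z xy yz; rewrite /eqmodZ -(subrK y x) -addrA.
exact: (rpredD xy yz).
Qed.

Canonical eqmodZ_equiv (R : realType) : equiv_rel R :=
  EquivRel (@eqmodZ R) (@eqmodZ_refl R) (@eqmodZ_sym R) (@eqmodZ_trans R).

Definition circle (R : realType) : topologicalType :=
  quotient_topology {eq_quot (eqmodZ_equiv R)}.

Definition circle_pi (R : realType) (x : R) : circle R :=
  \pi_{eq_quot (eqmodZ_equiv R)} x.

Section circle_maps.
Context {R : realType}.
Implicit Types (f : circle R -> circle R) (D : set (circle R)).

Definition discontinuities f : set (circle R) :=
  [set x | ~ {for x, continuous f}].

(* The lift [g] is total; only its values on the interval ]a, b[ matter. *)
Definition has_contracting_lift (lambda : R) f D : Prop :=
  exists (a b : R) (g : R -> R),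
    [/\ b - a <= 1,
        @circle_pi R @` `]a, b[ = D,
        {in `]a, b[, forall t, circle_pi (g t) = f (circle_pi t)},
        {within `]a, b[, continuous g} &
        {in `]a, b[ &, {homo g : s t / s < t}} /\
        lambda.-lipschitz_(`]a, b[) g].

Definition op_piecewise_contraction f : Prop :=
  [/\ finite_set (discontinuities f), discontinuities f !=set0 &
      exists lambda : R, 0 < lambda < 1 /\
        forall x, (~` discontinuities f) x ->
          has_contracting_lift lambda f
            (connected_component (~` discontinuities f) x)].

Definition right_continuous_at f (x : circle R) : Prop :=
  forall t : R, circle_pi t = x -> f (circle_pi s) @[s --> t^'+] --> f x.

Definition periodic_point f (x : circle R) : Prop :=
  exists2 n : nat, (0 < n)%N & iter n f x = x.

Definition forward_orbit f (x : circle R) : set (circle R) :=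
  range (fun n : nat => iter n f x).

Definition periodic_orbits f : set (set (circle R)) :=
  forward_orbit f @` periodic_point f.

End circle_maps.

(* Main.v *)
(* Upper bound: by right continuity, [f] is an increasing contraction on each
   arc [d, d'[ between consecutive discontinuities.  Among all pairs of a point
   of a periodic orbit [O] and a discontinuity, take a pair [(y, d)] minimizing
   the positively oriented distance [d - y].  For [0 <= s < d - y] no iterate
   separates [y] from [y + s], so [f^n (y + s) = f^n y + s_n] with
   [0 <= s_n <= lambda ^ n * s].  If [d] is also chosen for an orbit [O'], with
   [y' = y + s] in [O'], taking [n] a common period gives
   [s = s_n <= lambda ^ n * s], hence [s = 0] and [O = O'].  So [O |-> d] is
   injective.

   Sharpness: [x |-> (x + floor (k x) / k) / 2] has exactly the [k] fixed points
   [i / k], which are also its discontinuities. *)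
Require Import Defs.
From mathcomp Require Import all_boot all_order all_algebra generic_quotient.
From mathcomp Require Import all_classical all_reals all_analysis zify ring lra.
Import Order.TTheory GRing.Theory Num.Theory numFieldNormedType.Exports.
Local Open Scope classical_set_scope.
Local Open Scope ring_scope.

(** * Topology of the quotient circle and comparison of lifts *)

Section CircleTopology.
Context {R : realType}.
Implicit Types x y : R.

Lemma circle_pi_eqP x y :
  circle_pi x = circle_pi y <-> x - y \is a Num.int.
Proof. by split=> [/eqmodP|] //; move=> h; apply/eqmodP. Qed.

Lemma circle_pi_surj (c : circle R) : exists x, circle_pi x = c.
Proof. by exists (repr c); exact: reprK. Qed.

Lemma circle_pi_addr x z : z \is a Num.int -> circle_pi (x + z) = circle_pi x.
Proof. by move=> zZ; apply/circle_pi_eqP; rewrite addrAC subrr add0r. Qed.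

Lemma circle_pi_shift {x y} z : circle_pi x = circle_pi y ->
  circle_pi (x + z) = circle_pi (y + z).
Proof. by move=> /circle_pi_eqP h; apply/circle_pi_eqP; rewrite opprD addrACA subrr addr0. Qed.

Lemma circle_pi_inj x y : `|x - y| < 1 -> circle_pi x = circle_pi y -> x = y.
Proof.
move=> xy1 /circle_pi_eqP xyZ; apply/eqP; rewrite -subr_eq0; apply/eqP.
apply: contraTeq xy1 => xy0; rewrite -leNgt; exact: norm_intr_ge1.
Qed.

Lemma continuous_circle_pi : continuous (@circle_pi R).
Proof. exact: pi_continuous. Qed.

(** The preimage of the image of [A] is the union of the integer translates of [A], each of which is
    open. *)
Lemma open_circle_pi (A : set R) : open A -> open (@circle_pi R @` A).
Proof.
move=> oA; rewrite /open /= /quotient_open.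
rewrite (_ : _ @^-1` _ = \bigcup_(z in [set z : R | z \is a Num.int])
    ((fun x => x + z) @^-1` A)).
  apply: bigcup_open => z _; apply: open_comp => // x _.
  by apply: cvgD; [exact: cvg_id | exact: cvg_cst].
apply/seteqP; split=> [x [y Ay /circle_pi_eqP yx]|x [z zZ] Axz].
  by exists (y - x) => //=; rewrite addrC subrK.
by exists (x + z) => //; exact: circle_pi_addr.
Qed.

Lemma nbhs_circle_pi {x} {A : set R} :
  nbhs x A -> nbhs (circle_pi x) (@circle_pi R @` A).
Proof.
move=> xA; rewrite nbhsE.
have Ux : A° x by [].
have UA : A° `<=` A := @interior_subset _ A.
have oU := open_interior A; set U := A° in oU Ux UA.
exists (@circle_pi R @` U); last exact: image_subset.
by split; [exact: open_circle_pi | exists x].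
Qed.

(** Since the projection is open, continuity on the circle can be tested on lifts. *)
Lemma continuous_at_circle_pi (T : topologicalType) (f : circle R -> T) x :
  {for x, continuous (f \o @circle_pi R)} -> {for circle_pi x, continuous f}.
Proof.
move=> fc A fA; have /nbhs_circle_pi := fc A fA.
by apply: filterS => _ [y Ay <-].
Qed.

(** Gives uniqueness of one-sided limits on the circle and closedness of compact arcs. *)
Lemma circle_hausdorff : hausdorff_space (circle R).
Proof.
move=> c d cd; have [x xc] := circle_pi_surj c; have [y yd] := circle_pi_surj d.
apply: contrapT => cNd.
have xyN : x - y \isn't a Num.int.
  by apply/negP => /circle_pi_eqP xy; apply: cNd; rewrite -xc -yd.
pose n := Num.floor (x - y).
have nlt : n%:~R < x - y.
  rewrite lt_neqAle floor_le andbT; apply: contraNneq xyN => <-.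
  exact: intr_int.
have ltn : x - y < n%:~R + 1.
  by have /andP[_] := floor_itv (x - y); rewrite rmorphD.
(* Moving [x] and [y] by less than [e] each changes [x - y] by less than [2 * e], so the difference
   stays strictly between [n] and [n + 1] and is never an integer. *)
pose e := Num.min (x - y - n%:~R) (n%:~R + 1 - (x - y)) / 2.
have e0 : 0 < e.
  by rewrite divr_gt0 // lt_min subr_gt0 nlt subr_gt0 ltn.
have nx := nbhs_circle_pi (nbhsx_ballx x e e0).
have ny := nbhs_circle_pi (nbhsx_ballx y e e0).
move: cd; rewrite -xc -yd => /(_ _ _ nx ny).
case=> _ [[x' xx' <-] [y' yy' /circle_pi_eqP/intrP[m y'x'E]]].
have {}xx' : `|x - x'| < e := xx'; have {}yy' : `|y - y'| < e := yy'.
have e1 : 2 * e <= x - y - n%:~R by rewrite /e mulrC divfK// ge_min lexx.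
have e2 : 2 * e <= n%:~R + 1 - (x - y).
  by rewrite /e mulrC divfK// ge_min lexx orbT.
move: xx' yy'; rewrite !ltr_norml => /andP[x1 x2] /andP[y1 y2].
have [mn|nm] := leP (- m) n.
  have : (- m)%:~R <= n%:~R :> R by rewrite ler_int.
  by rewrite rmorphN /= -y'x'E; lra.
have : (n + 1)%:~R <= (- m)%:~R :> R by rewrite ler_int; lia.
by rewrite rmorphN rmorphD /= -y'x'E; lra.
Qed.

End CircleTopology.

(** * Elementary properties of periodic orbits *)

Section PeriodicOrbits.
Context {R : realType} {f : circle R -> circle R}.
Implicit Types (c : circle R) (O : set (circle R)).

Lemma periodic_orbit_nonempty {O} : periodic_orbits f O -> O !=set0.
Proof. by move=> [c _ <-]; exists c; exists 0%N. Qed.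

Lemma periodic_orbit_period {O c} : periodic_orbits f O -> O c ->
  exists2 n, (0 < n)%N & iter n f c = c.
Proof.
move=> [b [n n0 nb] <-] [m _ <-]; exists n => //.
by rewrite -iterD addnC iterD nb.
Qed.

Lemma periodic_orbit_iter {O c} n : periodic_orbits f O -> O c -> O (iter n f c).
Proof. by move=> [b _ <-] [m _ <-]; exists (n + m)%N => //; rewrite iterD. Qed.

Lemma periodic_orbit_eq {O c} : periodic_orbits f O -> O c -> O = forward_orbit f c.
Proof.
move=> perO Oc; apply/seteqP; split=> [|_ [n _ <-]]; last exact: periodic_orbit_iter.
case: perO Oc => b [n n0 nb] <- [m _ <-] _ [i _ <-].
(* As [n] is positive, [n * m] is a multiple of the period that is at least [m]: [n * m - m] further
   steps lead from [iter m f b] back to [b]. *)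
exists (i + (n * m - m))%N => //; rewrite -iterD -addnA subnK ?leq_pmull//.
by rewrite iterD mulnC iterM (iter_fix m nb).
Qed.

Lemma finite_periodic_orbit {O} : periodic_orbits f O -> finite_set O.
Proof.
move=> [b [n n0 nb] <-].
apply: sub_finite_set (finite_image (fun i => iter i f b) (finite_II n)).
move=> _ [i _ <-]; exists (i %% n)%N; first exact: ltn_pmod.
by rewrite {2}(divn_eq i n) addnC iterD iterM (iter_fix _ nb).
Qed.

End PeriodicOrbits.

Lemma finite_set_has_min {R : realType} {A : set R} : finite_set A -> A !=set0 ->
  exists r, A r /\ forall s, A s -> r <= s.
Proof.
move=> /finite_seqP[s ->]; elim: s => [[]//|a s IH] _.
have [->|s0] := eqVneq s [::].
  by exists a; split=> [|b] /=; rewrite mem_seq1 => // /eqP ->.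
have [|r [rs rmin]] := IH.
  by case: s s0 {IH} => // b s _; exists b; rewrite /= mem_head.
exists (Num.min a r); split.
  by rewrite /= /Num.min; case: ifP; rewrite inE ?eqxx// rs orbT.
move=> b; rewrite /= inE ge_min => /predU1P[->|/rmin ->]; rewrite ?lexx ?orbT//.
Qed.

(** * At most as many periodic orbits as discontinuities *)

Section UpperBound.
Context {R : realType} (f : circle R -> circle R).
Implicit Types x y z : R.
Local Notation Disc := (discontinuities f).
Hypothesis f_rc : forall c, Disc c -> right_continuous_at f c.
Variable lambda : R.
Hypothesis lambda01 : 0 < lambda < 1.
Hypothesis f_lift : forall c, (~` Disc) c ->
  has_contracting_lift lambda f (connected_component (~` Disc) c).

Lemma circle_map_right_cvg y :
  f (circle_pi s) @[s --> y^'+] --> f (circle_pi y).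
Proof.
have [|yc] := pselect (Disc (circle_pi y)); first by move=> /f_rc; apply.
apply: cvg_at_right_filter.
apply: (continuous_comp (@continuous_circle_pi R y)).
exact: contrapT.
Qed.

(** The half-open arc after [y] lies in one component, where a lift [g] is increasing and Lipschitz.
    The point [y] may itself be a discontinuity: right continuity still identifies [f (circle_pi y)]
    with the right limit of [g], so the estimate extends to [y]. *)
Lemma contraction_on_arc y z : y <= z ->
  (forall t, y < t <= z -> ~ Disc (circle_pi t)) ->
  forall a, circle_pi a = f (circle_pi y) ->
  exists w, 0 <= w <= lambda * (z - y) /\ f (circle_pi z) = circle_pi (a + w).
Proof.
rewrite le_eqVlt => /predU1P[<- _ a ya|yz arcN a aE].
  by exists 0; rewrite subrr mulr0 lexx addr0 ya.
have [c [b [g [cb1 compE gE _ [ginc glip]]]]] :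
    has_contracting_lift lambda f (connected_component (~` Disc) (circle_pi z)).
  by apply: f_lift; apply: arcN; rewrite yz lexx.
(* The image of []y, z]] is connected, contains [circle_pi z] and avoids [Disc]. *)
have arc_sub t : y < t <= z -> (@circle_pi R @` `]c, b[) (circle_pi t).
  rewrite compE => ytz.
  apply: (@connected_component_max _ _ (@circle_pi R @` `]y, z])).
  - by exists z => //=; rewrite in_itv/= yz lexx.
  - by move=> _ [u + <-]; rewrite /= in_itv/=; exact: arcN.
  - apply: connected_continuous_connected.
      exact/connected_intervalP/interval_is_interval.
    by apply: continuous_subspaceT; exact: continuous_circle_pi.
  - by exists t => //=; rewrite in_itv.
have [z' + z'z] : (@circle_pi R @` `]c, b[) (circle_pi z).
  by apply: arc_sub; rewrite yz lexx.
rewrite /= in_itv/= => /andP[cz' z'b].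
(* The integer translation taking [z] to [z'] places the arc in the coordinates of the lift [g]. *)
pose y' := y + (z' - z).
have shiftE t : circle_pi (t + (z' - z)) = circle_pi t.
  by apply: circle_pi_addr; exact/circle_pi_eqP.
(* Otherwise [c] would lie in []y', z']], so [circle_pi c] would be in the image of []c, b[]; this
   is impossible because [b - c <= 1]. *)
have cy' : c <= y'.
  rewrite leNgt; apply/negP => y'c.
  have /arc_sub[c' + c'c] : y < c - (z' - z) <= z by rewrite /y' in y'c; lra.
  rewrite /= in_itv/= => /andP[cc' c'b].
  have := shiftE (c - (z' - z)); rewrite -c'c subrK => /circle_pi_inj.
  move=> cE; have c'E : c = c'.
    by apply: cE; rewrite ltr_norml; apply/andP; split; lra.
  by rewrite -c'E ltxx in cc'.
have y'z' : y' < z' by rewrite /y'; lra.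
have in_cb t : y' < t <= z' -> t \in `]c, b[.
  by rewrite in_itv/= => /andP[y't tz']; apply/andP; split; lra.
have g_le : {in `]y', z'] &, {homo g : s t / s <= t}}.
  move=> s t; rewrite !in_itv/= => ys yt; rewrite le_eqVlt => /predU1P[->//|st].
  by apply/ltW/ginc; rewrite ?in_cb.
have g_lip t : y' < t <= z' -> g z' - g t <= lambda * (z' - t).
  move=> yt; have zz : y' < z' <= z' by rewrite y'z' lexx.
  have := glip (z', t) (conj (in_cb _ zz) (in_cb _ yt)).
  rewrite /= [`|z' - t|]ger0_norm; last by case/andP: yt; lra.
  exact/le_trans/ler_norm.
pose A := g @` `]y', z'].
have Az : A (g z') by exists z' => //=; rewrite in_itv/= y'z' lexx.
have A_lb : lbound A (g z' - lambda * (z' - y')).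
  move=> _ [t + <-]; rewrite /= in_itv/= => yt; have := g_lip t yt.
  have : lambda * (z' - t) <= lambda * (z' - y').
    by rewrite ler_wpM2l//; case/andP: yt lambda01; lra.
  by lra.
(* A monotone function bounded below has its infimum as right limit; the bound comes from the
   Lipschitz estimate. *)
have g_cvg : g s @[s --> y'^'+] --> inf A.
  apply: nondecreasing_at_right_cvgr; rewrite ?bnd_simp//.
  by exists (g z' - lambda * (z' - y')).
have infA : f (circle_pi y) = circle_pi (inf A).
  rewrite -(shiftE y) -/y'.
  apply: (cvg_unique (@circle_hausdorff R) (F := f (circle_pi s) @[s --> y'^'+])).
    exact: circle_map_right_cvg.
  have gpi : circle_pi (g s) @[s --> y'^'+] --> circle_pi (inf A).
    by apply: continuous_cvg g_cvg; exact: continuous_circle_pi.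
  apply: cvg_trans gpi; apply: near_eq_cvg; near=> s.
  apply: gE; apply: in_cb; apply/andP; split; near: s.
    exact: nbhs_right_gt.
  exact: nbhs_right_le.
exists (g z' - inf A); split.
  rewrite subr_ge0; apply/andP; split.
    by apply: ge_inf => //; exists (g z' - lambda * (z' - y')).
  have : g z' - lambda * (z' - y') <= inf A by apply: lb_le_inf => //; exists (g z').
  by rewrite /y'; lra.
rewrite -z'z -gE; last by rewrite in_cb// y'z' lexx.
rewrite -[in LHS](subrK (inf A) (g z')) addrC; apply: circle_pi_shift.
by rewrite aE infA.
Unshelve. all: by end_near.
Qed.

(** Induction on [n]: the displacement never exceeds [s < r], so the arc from the iterate of [x] to
    that of [x + s] contains no discontinuity past its start, and one more step multiplies the bound
    by [lambda]. *)
Lemma iter_on_arc x (r : R) :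
  (forall n a, circle_pi a = iter n f (circle_pi x) ->
     forall t, a < t < a + r -> ~ Disc (circle_pi t)) ->
  forall s, 0 <= s < r -> forall n a, circle_pi a = iter n f (circle_pi x) ->
  exists w, 0 <= w <= lambda ^+ n * s /\
    iter n f (circle_pi (x + s)) = circle_pi (a + w).
Proof.
move=> gap s /andP[s0 sr]; elim=> [|n IH] a aE.
  exists s; rewrite expr0 mul1r s0 lexx; split=> //.
  exact: circle_pi_shift.
have [b bE] := circle_pi_surj (iter n f (circle_pi x)).
have [w [/andP[w0 ws] fw]] := IH b bE.
have /andP[l0 l1] := lambda01.
have wr : w < r.
  apply: le_lt_trans ws _; apply: le_lt_trans sr.
  by rewrite ler_piMl// exprn_ile1// ltW.
have [|||w' [/andP[w'0 w'w] fw']] := @contraction_on_arc b (b + w) _ _ a.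
- by rewrite lerDl.
- by move=> t /andP[bt tw]; apply: (gap n b bE); rewrite bt (le_lt_trans tw)// ltrD2l.
- by rewrite aE bE.
exists w'; split; last by rewrite iterS fw.
rewrite w'0 (le_trans w'w)// addrAC subrr add0r exprS -mulrA.
by rewrite ler_wpM2l// ltW.
Qed.

(* The points of [y, d[ then follow the orbit [O] under iteration, so [d]
   cannot play this role for two distinct orbits. *)
Definition nearest (O : set (circle R)) (e : circle R)  : Prop :=
  exists y d : R, [/\ circle_pi d = e, O (circle_pi y), y < d <= y + 1 &
   forall a, O (circle_pi a) ->
     forall t, a < t < a + (d - y) -> ~ Disc (circle_pi t)].

(** A pair minimizing the positive distance exists because only finitely many distances occur. *)
Lemma nearest_discontinuity {O} : finite_set Disc -> Disc !=set0 ->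
  periodic_orbits f O -> exists e, Disc e /\ nearest O e.
Proof.
move=> Dfin [e0 De0] perO.
(* Distances are normalized to []0, 1]], so an orbit point that is a discontinuity is at distance 1
   from itself, not 0. This fits the arcs in [nearest], which exclude their starting point. *)
pose S := [set r : R | exists y d, [/\ O (circle_pi y), Disc (circle_pi d),
  r = d - y & 0 < r <= 1]].
have frac (u v : R) : let r := u - v - (Num.ceil (u - v))%:~R + 1 in 0 < r <= 1.
  have /andP[/=] := ceil_itv (u - v); rewrite rmorphB /=.
  by move=> h1 h2; apply/andP; split; lra.
(* A number in []0, 1]] is determined by its class modulo 1, hence by the two points on the circle;
   [gap] computes it from canonical representatives. *)
have Sfin : finite_set S.
  pose gap (p : circle R * circle R) : R :=
    let u : R := repr p.2 - repr p.1 in u - (Num.ceil u)%:~R + 1.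
  apply: (@sub_finite_set _ _ (gap @` (O `*` Disc))); last first.
    by apply/finite_image/finite_setX => //; exact: finite_periodic_orbit perO.
  move=> r [y [d [Oy Dd rE r01]]]; exists (circle_pi y, circle_pi d) => //; rewrite /gap /=.
  set u := repr (circle_pi d); set v := repr (circle_pi y).
  have ud : circle_pi u = circle_pi d by exact: reprK.
  have vy : circle_pi v = circle_pi y by exact: reprK.
  have /andP[r'0 r'1] := frac u v; set r' := _ + 1 in r'0 r'1 *.
  apply: circle_pi_inj; first by case/andP: r01; rewrite ltr_norml; lra.
  apply/circle_pi_eqP; rewrite rE /r'.
  move/circle_pi_eqP : ud => /intrP[m mE]; move/circle_pi_eqP : vy => /intrP[n nE].
  apply/intrP; exists (m - n - Num.ceil (u - v) + 1).
  by rewrite !(rmorphD, rmorphN) /= -mE -nE; ring.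
have S0 : S !=set0.
  have [c Oc] := periodic_orbit_nonempty perO.
  have [v vE] := circle_pi_surj c; have [u uE] := circle_pi_surj e0.
  exists (u - v - (Num.ceil (u - v))%:~R + 1); exists v, (u - (Num.ceil (u - v))%:~R + 1).
  rewrite vE -addrA circle_pi_addr ?uE; last first.
    by rewrite rpredD ?rpred1// rpredN intr_int.
  by split; [|by []|ring|exact: frac].
have [r [[y [d [Oy Dd -> /andP[r0 r1]]]] rmin]] := finite_set_has_min Sfin S0.
exists (circle_pi d); split=> //; exists y, d; split=> //.
  by apply/andP; split; lra.
(* A discontinuity inside the arc would give the distance [t - a], smaller than the minimum. *)
move=> a Oa t /andP[at1 at2] Dt.
have /rmin : S (t - a).
  by exists a, t; split=> //; apply/andP; split; lra.
lra.
Qed.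

Lemma nearest_inj {O O' e} : periodic_orbits f O -> periodic_orbits f O' ->
  nearest O e -> nearest O' e -> O = O'.
Proof.
move=> perO perO' [y [d [de Oy /andP[yd dy] gap]]] [y0 [d' [d'e Oy0 /andP[yd' dy'] gap0]]].
(* The lifts [d] and [d'] of [e] differ by an integer; after this translation both orbits are
   measured against the same lift [d]. *)
pose y' := y0 + (d - d').
have y'E : circle_pi y' = circle_pi y0.
  by apply: circle_pi_addr; apply/circle_pi_eqP; rewrite de d'e.
have y'd : y' < d by rewrite /y'; lra.
have dy'1 : d <= y' + 1 by rewrite /y'; lra.
have Oy' : O' (circle_pi y') by rewrite y'E.
have gap' a : O' (circle_pi a) ->
    forall t, a < t < a + (d - y') -> ~ Disc (circle_pi t).
  have -> : d - y' = d' - y0 by rewrite /y'; ring.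
  exact: gap0.
clearbody y'; move: y'd dy'1 Oy' gap' => {y'E dy' yd' gap0 Oy0 y0 d' d'e e de}.
(* With a common [d] the two orbits play symmetric roles. *)
wlog yy' : O O' y y' perO perO' Oy yd dy gap / y <= y'.
  move=> wl; have [yy'|/ltW yy'] := leP y y'; first exact: (wl O O' y y').
  by move=> y'd dy'1 Oy' gap'; apply/esym; apply: (wl O' O y' y).
move=> y'd dy'1 Oy' gap'.
have [p p0 py] := periodic_orbit_period perO Oy.
have [q q0 qy] := periodic_orbit_period perO' Oy'.
(* The common period [p * q] returns both points to themselves, so the displacement [y' - y] equals
   its own contracted image [w] and must vanish. *)
have [|||w [/andP[w0 wle]]] := @iter_on_arc y (d - y) _ (y' - y) _ (p * q)%N y.
- by move=> n a aE; apply: gap; rewrite aE; exact: periodic_orbit_iter.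
- by apply/andP; split; lra.
- by rewrite mulnC iterM (iter_fix _ py).
rewrite (addrC y) subrK iterM (iter_fix _ qy) => y'w.
have /andP[l0 l1] := lambda01.
have l_lt1 : lambda ^+ (p * q) < 1 by rewrite exprn_ilt1 ?ltW// -lt0n muln_gt0 p0.
have wle' : lambda ^+ (p * q) * (y' - y) <= y' - y.
  by rewrite ler_piMl ?subr_ge0// ltW.
have yw : y' = y + w.
  by apply: circle_pi_inj => //; rewrite ltr_norml; apply/andP; split; lra.
have {}yy' : y' = y.
  apply/eqP; rewrite eq_le yy' andbT -subr_le0 leNgt; apply/negP => y'y.
  have : lambda ^+ (p * q) * (y' - y) < y' - y by rewrite gtr_pMl.
  lra.
by rewrite (periodic_orbit_eq perO Oy) (periodic_orbit_eq perO' Oy') yy'.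
Qed.

Lemma card_periodic_orbits_le : finite_set Disc -> Disc !=set0 ->
  (periodic_orbits f #<= Disc)%card.
Proof.
move=> Dfin D0.
have [h hP] : {h : set (circle R) -> circle R & forall O, periodic_orbits f O ->
    Disc (h O) /\ nearest O (h O)}.
  apply: (@choice _ _ (fun O e => periodic_orbits f O -> Disc e /\ nearest O e)) => O.
  have [perO|nper] := pselect (periodic_orbits f O).
    by have [e eP] := nearest_discontinuity Dfin D0 perO; exists e.
  (* The choice function is total: a set that is not a periodic orbit gets an arbitrary
     discontinuity. *)
  by case: D0 => e _; exists e.
have h_inj : {in periodic_orbits f &, injective h}.
  move=> O O' /set_mem perO /set_mem perO' hOO'.
  have [_ nO] := hP O perO; have [_ nO'] := hP O' perO'.
  by apply: (nearest_inj perO perO' nO); rewrite hOO'.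
rewrite -(card_le_eql (inj_card_eq h_inj)); apply: subset_card_le.
by move=> _ [Q /hP [DhO _] <-].
Qed.

End UpperBound.

(** * A map attaining the bound *)

Section HalvingMap.
Context {R : realType} {k : nat}.
Hypothesis k_gt0 : (0 < k)%N.
Implicit Types x y z : R.
Local Notation K := (k%:R : R).

(** Rounding down to a multiple of [1 / k]; the equation [node_below x = x] thus serves below to say
    that [x] is a node. *)
Definition node_below x : R := (Num.floor (K * x))%:~R / K.

(* On each arc [i / k, (i + 1) / k[ this is the contraction by 1/2 towards the
   left endpoint of the arc. *)
Definition halving_map (c : circle R) : circle R :=
  circle_pi ((repr c + node_below (repr c)) / 2).

Let K_gt0 : 0 < K. Proof. by rewrite ltr0n. Qed.
Let invK_gt0 : 0 < K^-1. Proof. by rewrite invr_gt0. Qed.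
Let invK_le1 : K^-1 <= 1. Proof. by rewrite invf_le1// ler1n. Qed.

Lemma node_belowD x z : z \is a Num.int -> node_below (x + z) = node_below x + z.
Proof.
move=> zZ; have KzZ : K * z \is a Num.int by rewrite rpredM// natr_int.
rewrite /node_below mulrDr floorDrz// rmorphD /= (floorK KzZ).
by rewrite mulrDl [K * z]mulrC mulfK// gt_eqF.
Qed.

(** Adding an integer to the representative adds it to [node_below] too, so the half-sum moves by
    that same integer. *)
Lemma halving_mapE x : halving_map (circle_pi x) = circle_pi ((x + node_below x) / 2).
Proof.
rewrite /halving_map; set y : R := repr _.
have /circle_pi_eqP yxZ : circle_pi y = circle_pi x by exact: reprK.
have -> : node_below y = node_below x + (y - x).
  by rewrite -node_belowD// addrC subrK.
rewrite (_ : _ / 2 = (x + node_below x) / 2 + (y - x)); last by field.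
exact: circle_pi_addr.
Qed.

Lemma node_below_itv x : node_below x <= x < node_below x + K^-1.
Proof.
have /andP[h1 h2] := floor_itv (K * x).
rewrite /node_below ler_pdivrMr// [x * _]mulrC h1 /=.
by rewrite -[X in _ + X]mul1r -mulrDl ltr_pdivlMr// [x * _]mulrC; rewrite rmorphD in h2.
Qed.

Lemma node_belowP (n : int) x :
  n%:~R / K <= x < n%:~R / K + K^-1 -> node_below x = n%:~R / K.
Proof.
move=> /andP[h1 h2]; rewrite /node_below (@floor_def _ _ n)//.
rewrite -ler_pdivrMl// [_^-1 * _]mulrC h1 /= -ltr_pdivlMl// [_^-1 * _]mulrC.
by rewrite rmorphD /= mulrDl mul1r.
Qed.

Lemma node_below_const x y :
  node_below x <= y < node_below x + K^-1 -> node_below y = node_below x.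
Proof. exact: node_belowP. Qed.

Lemma node_below_left x y : node_below x = x -> x - K^-1 <= y < x ->
  node_below y = x - K^-1.
Proof.
move=> xx; have -> : x - K^-1 = (Num.floor (K * x) - 1)%:~R / K.
  by rewrite -[in LHS]xx /node_below rmorphB /= mulrBl mul1r.
move=> xy; apply: node_belowP; move: xy; rewrite -[X in _ < X]xx /node_below.
by rewrite rmorphB /= mulrBl mul1r subrK.
Qed.

(** Where [node_below] is constant the map is affine. Stating this for a general filter covers left,
    right and two-sided limits at once. *)
Lemma halving_map_cvg (F : set_system R) (FF : Filter F) x a :
  F --> x -> (\forall s \near F, node_below s = a) ->
  halving_map (circle_pi s) @[s --> F] --> circle_pi ((x + a) / 2).
Proof.
move=> Fx nF.
have : circle_pi ((s + a) / 2) @[s --> F] --> circle_pi ((x + a) / 2).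
  apply: (@continuous_cvg _ _ _ F FF (fun s : R => (s + a) / 2) (@circle_pi R)).
    exact: continuous_circle_pi.
  by apply: cvgM; [apply: cvgD => //; exact: cvg_cst|exact: cvg_cst].
apply: cvg_trans; apply: near_eq_cvg; near=> s.
by rewrite halving_mapE (near nF s).
Unshelve. all: by end_near.
Qed.

Lemma halving_map_right_cvg x :
  halving_map (circle_pi s) @[s --> x^'+] --> halving_map (circle_pi x).
Proof.
rewrite halving_mapE; apply: halving_map_cvg; first exact: cvg_at_right_filter.
have /andP[xl xr] := node_below_itv x.
near=> s; apply: node_below_const; apply/andP; split.
  by apply: le_trans xl _; apply/ltW; near: s; exact: nbhs_right_gt.
by near: s; exact: nbhs_right_lt.
Unshelve. all: by end_near.
Qed.

(** Away from nodes [node_below] is locally constant. At a node [x] the left limit is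
    [x - 1 / (2 * k)] while the value is [x]; these differ by less than 1, hence remain distinct on
    the circle. *)
Lemma discontinuities_halving_map :
  discontinuities halving_map = @circle_pi R @` [set x | node_below x = x].
Proof.
apply/seteqP; split=> [c|_ [x xx <-] xc].
  have [x <-] := circle_pi_surj c; move=> xd; exists x => //=.
  apply: contrapT => xx; apply: xd; apply: continuous_at_circle_pi.
  have /andP[xl xr] := node_below_itv x.
  have {}xl : node_below x < x by rewrite lt_neqAle xl andbT; exact/eqP.
  change (halving_map (circle_pi s) @[s --> x] --> halving_map (circle_pi x)).
  rewrite halving_mapE; apply: halving_map_cvg => //.
  near=> s; apply: node_below_const; apply/andP; split.
    by apply/ltW; near: s; exact: lt_nbhsr.
  by near: s; exact: lt_nbhsl.
have fx : halving_map (circle_pi s) @[s --> x^'-] --> halving_map (circle_pi x).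
  apply: cvg_at_left_filter.
  exact: (continuous_comp (@continuous_circle_pi R x)).
have : halving_map (circle_pi s) @[s --> x^'-] --> circle_pi ((x + (x - K^-1)) / 2).
  apply: halving_map_cvg; first exact: cvg_at_left_filter.
  near=> s; apply: node_below_left => //; apply/andP; split.
    by apply/ltW; near: s; apply: nbhs_left_gt; rewrite ltrBlDr ltrDl.
  by near: s; exact: nbhs_left_lt.
move=> /(cvg_unique (@circle_hausdorff R) fx); rewrite halving_mapE xx.
have K'0 := invK_gt0; have K'1 := invK_le1.
move=> /circle_pi_inj h; have : (x + x) / 2 = (x + (x - K^-1)) / 2.
  by apply: h; rewrite ltr_norml; apply/andP; split; lra.
lra.
Unshelve. all: by end_near.
Qed.

Lemma halving_map_node {x} : node_below x = x -> halving_map (circle_pi x) = circle_pi x.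
Proof. by move=> xx; rewrite halving_mapE xx; congr circle_pi; field. Qed.

Lemma card_discontinuities_halving_map :
  (discontinuities halving_map #= `I_k)%card.
Proof.
have -> : discontinuities halving_map = (fun i : nat => circle_pi (i%:R / K)) @` `I_k.
  rewrite discontinuities_halving_map; apply/seteqP; split=> [_ [x xx <-]|_ [i ik <-]].
    (* The node is [n / k]; reducing [n] modulo [k] translates it by the integer quotient. *)
    pose n := Num.floor (K * x); exists `|(n %% k)%Z|%N.
      by rewrite /= -ltz_nat gez0_abs ?modz_ge0 ?ltz_pmod// -?lt0n// gt_eqF.
    apply/circle_pi_eqP; rewrite -xx /node_below -/n.
    rewrite natr_absz ger0_norm; last by rewrite modz_ge0// gt_eqF.
    move: (n %/ k)%Z (n %% k)%Z (divz_eq n k) => q r ->.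
    rewrite intrD intrM mulrDl mulfK ?gt_eqF//.
    by rewrite opprD addrCA subrr addr0 rpredN intr_int.
  exists (i%:R / K) => //=; apply: (@node_belowP i).
  by rewrite -[i%:~R]/(i%:R) lexx ltrDl.
apply: inj_card_eq => i j /set_mem /= ik /set_mem /= jk /circle_pi_inj ij.
have : i%:R / K = j%:R / K.
  apply: ij; rewrite -mulrBl normrM [`|K^-1|]gtr0_norm// ltr_pdivrMr// mul1r.
  have : i%:R < K by rewrite ltr_nat.
  have : j%:R < K by rewrite ltr_nat.
  have : 0 <= i%:R :> R by [].
  have : 0 <= j%:R :> R by [].
  by rewrite ltr_norml => *; apply/andP; split; lra.
by move=> /(divIf (lt0r_neq0 K_gt0))/eqP; rewrite eqr_nat => /eqP.
Qed.

(** The open arc between consecutive nodes is connected, and it is both open and closed relative to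
    the component. *)
Lemma component_halving_map x : node_below x < x ->
  connected_component (~` discontinuities halving_map) (circle_pi x) =
  @circle_pi R @` `]node_below x, node_below x + K^-1[.
Proof.
move=> xl; have /andP[_ xr] := node_below_itv x.
set a := node_below x in xl xr *; set C := connected_component _ _.
have aN t : a < t < a + K^-1 -> ~ discontinuities halving_map (circle_pi t).
  rewrite discontinuities_halving_map => /andP[at1 at2] [s ss /circle_pi_eqP/intrP[m mE]].
  have : node_below t = t.
    have -> : t = s - m%:~R by rewrite -mE; lra.
    by rewrite node_belowD ?ss// rpredN intr_int.
  by rewrite (@node_below_const x) ?(ltW at1)// -/a => ta; rewrite ta ltxx in at1.
have aD t : t = a \/ t = a + K^-1 -> discontinuities halving_map (circle_pi t).
  rewrite discontinuities_halving_map => -[]->.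
    by exists a => //=; apply: node_below_const; rewrite -/a lexx ltrDl.
  exists (a + K^-1) => //=.
  have -> : a + K^-1 = (Num.floor (K * x) + 1)%:~R / K.
    by rewrite rmorphD /= mulrDl mul1r.
  by apply: node_belowP; rewrite lexx ltrDl.
have Cx : C (circle_pi x).
  by apply: connected_component_refl; apply: aN; rewrite xl xr.
apply/seteqP; split; last first.
  apply: connected_component_max.
  - by exists x => //=; rewrite in_itv/= xl xr.
  - by move=> _ [t + <-]; rewrite /= in_itv/=; exact: aN.
  - apply: connected_continuous_connected.
      exact/connected_intervalP/interval_is_interval.
    by apply: continuous_subspaceT; exact: continuous_circle_pi.
have CE : C `&` @circle_pi R @` `]a, a + K^-1[ = C.
  apply: component_connected.
  - by exists (circle_pi x); split=> //; exists x => //=; rewrite in_itv/= xl xr.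
  - by exists (@circle_pi R @` `]a, a + K^-1[) => //;
    apply: open_circle_pi; exact: interval_open.
  (* Relative closedness: the closed arc is compact, and its endpoints are discontinuities, hence
     outside the component. *)
  exists (@circle_pi R @` `[a, a + K^-1]).
    apply: compact_closed; first exact: circle_hausdorff.
    apply: continuous_compact; last exact: segment_compact.
    by apply: continuous_subspaceT; exact: continuous_circle_pi.
  apply/seteqP; split=> c [Cc [t + tc]]; rewrite /= in_itv/= => /andP[at1 at2].
    by split=> //; exists t => //=; rewrite in_itv/= !ltW.
  split=> //; exists t => //=; rewrite in_itv/= !lt_neqAle at1 at2 !andbT.
  have cN : ~ discontinuities halving_map (circle_pi t).
    by rewrite tc; exact: connected_component_sub Cc.
  by apply/andP; split; apply/eqP => e; apply: cN; apply: aD; [left|right].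
by rewrite -CE; exact: subIsetr.
Qed.

Lemma halving_map_contraction : op_piecewise_contraction halving_map.
Proof.
split.
- by apply/finite_setP; exists k; exact: card_discontinuities_halving_map.
- exists (circle_pi 0); rewrite discontinuities_halving_map; exists 0 => //=.
  by rewrite /node_below mulr0 floor0 mul0r.
exists 2^-1; split; first by apply/andP; split; lra.
move=> c; have [x <-] := circle_pi_surj c; move=> xN.
have /andP[xl xr] := node_below_itv x.
have {}xl : node_below x < x.
  rewrite lt_neqAle xl andbT; apply/eqP => xx; apply: xN.
  by rewrite discontinuities_halving_map; exists x.
exists (node_below x), (node_below x + K^-1), (fun t => (t + node_below x) / 2).
split.
- by rewrite addrAC subrr add0r.
- by rewrite component_halving_map.
- move=> t; rewrite in_itv/= => /andP[xt tx]; rewrite halving_mapE.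
  by rewrite (@node_below_const x t) ?(ltW xt).
- apply: continuous_subspaceT => t.
  by apply: cvgM; [apply: cvgD; [exact: cvg_id|exact: cvg_cst]|exact: cvg_cst].
split=> [s t _ _ st|[s t] _] /=; first lra.
rewrite -mulrBl opprD addrACA subrr addr0 normrM mulrC ler_wpM2r//.
by rewrite ger0_norm.
Qed.

(** Every discontinuity is a fixed node, whose orbit is a singleton, so [set1] injects the
    discontinuities into the periodic orbits. *)
Lemma card_periodic_orbits_halving_map_ge :
  (`I_k #<= periodic_orbits halving_map)%card.
Proof.
rewrite -(card_le_eql card_discontinuities_halving_map).
have set1_inj : {in discontinuities halving_map &, injective (@set1 (circle R))}.
  by move=> c d _ _ /seteqP[/(_ c erefl)].
rewrite -(card_le_eql (inj_card_eq set1_inj)); apply: subset_card_le.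
rewrite discontinuities_halving_map => _ [_ [x xx <-] <-].
have fx := halving_map_node xx.
exists (circle_pi x); first by exists 1%N.
by apply/seteqP; split=> [_ [n _ <-]|_ ->] /=; [rewrite (iter_fix n fx)|exists 0%N].
Qed.

End HalvingMap.

Theorem corollary2 (R : realType) (k : nat) (hk : (0 < k)%N) :
  (forall f : circle R -> circle R,
     op_piecewise_contraction f ->
     (discontinuities f #= `I_k)%card ->
     (forall x, discontinuities f x -> right_continuous_at f x) ->
     (periodic_orbits f #<= `I_k)%card) /\
  (exists f : circle R -> circle R,
     [/\ op_piecewise_contraction f,
         (discontinuities f #= `I_k)%card,
         (forall x, discontinuities f x -> right_continuous_at f x) &
         (periodic_orbits f #= `I_k)%card]).
Proof.
(* Established first because it is used twice: as the first claim, and to turn the lower bound for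
   [halving_map] into an exact count. *)
have ub (f : circle R -> circle R) : op_piecewise_contraction f ->
    (discontinuities f #= `I_k)%card ->
    (forall x, discontinuities f x -> right_continuous_at f x) ->
    (periodic_orbits f #<= `I_k)%card.
  move=> [Dfin D0 [lambda [lambda01 f_lift]]] Dk f_rc.
  rewrite -(card_le_eqr Dk).
  exact: (card_periodic_orbits_le f f_rc lambda lambda01 f_lift Dfin D0).
split=> //; exists (@halving_map R k).
have f_rc x : discontinuities (@halving_map R k) x ->
    right_continuous_at (@halving_map R k) x.
  by move=> _ t <-; exact: halving_map_right_cvg.
split=> //; first exact: halving_map_contraction.
  exact: card_discontinuities_halving_map.
rewrite card_eq_le card_periodic_orbits_halving_map_ge// andbT.
apply: ub => //; first exact: halving_map_contraction.
exact: card_discontinuities_halving_map.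
Qed.
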